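(* Let $d\ge 3$. There are at least $2^{d-1}-2$ different permutations $\sigma$ of $[d-1]$ that are universal types for oriented lines in $\mathbb{R}^d$, i.e. such that for every $n\ge d-1$ there exists a sequence of $n$ oriented lines in $\mathbb{R}^d$ which is homogeneous of type $\sigma$.
   Context: An oriented line in $\mathbb{R}^d$ is an equivalence class of pairs $(a,v)$ with $a,v\in\mathbb{R}^d$, $v\neq 0$, where $(a,v)\sim(a+\alpha v,\beta v)$ for all $\alpha\in\mathbb{R}$, $\beta>0$. For an ordered $(d-1)$-tuple $L_1,\ldots,L_{d-1}$ with $L_i$ represented by $(a_i,v_i)$, set $h_i=\det(a_i,v_1,\ldots,v_{d-1})$ (determinant of the $d\times d$ matrix with these columns). The tuple is in general position if the $h_i$ are pairwise distinct, and then its type is the permutation $\sigma$ of $[d-1]$ with $h_{\sigma(1)}<\dots<h_{\sigma(d-1)}$. A sequence $K_1,\ldots,K_n$ of oriented lines is homogeneous of type $\sigma$ if every subsequence $K_{i_1},\ldots,K_{i_{d-1}}$ with $i_1<\dots<i_{d-1}$ is in general position and has type $\sigma$. *)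

(* Defs.v *)
From HB Require Import structures.
From mathcomp Require Import all_boot all_order all_algebra all_fingroup.
From mathcomp Require Import generic_quotient.
From mathcomp Require Import boolp reals.

Set Implicit Arguments.
Unset Strict Implicit.
Unset Printing Implicit Defensive.

Import Order.TTheory GRing.Theory Num.Theory.
Local Open Scope ring_scope.
Local Open Scope quotient_scope.

Section OrientedLines.
Variables (R : realType) (d : nat).

Definition line_rep := {p : 'cV[R]_d * 'cV[R]_d | p.2 != 0}.

Definition base_point (p : line_rep) : 'cV[R]_d := (val p).1.
Definition direction (p : line_rep) : 'cV[R]_d := (val p).2.

Definition same_line (p q : line_rep) : Prop :=
  exists alpha beta : R, [/\ 0 < beta,
    base_point q = base_point p + alpha *: direction p &
    direction q = beta *: direction p].

Definition same_lineb (p q : line_rep) : bool := `[< same_line p q >].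

Lemma same_lineb_refl : reflexive same_lineb.
Proof.
move=> p; apply/asboolP; exists 0, 1.
by rewrite ltr01 scale0r addr0 scale1r.
Qed.

Lemma same_line_sym p q : same_line p q -> same_line q p.
Proof.
case=> [al [be [be0 ea ev]]]; exists (- (al / be)), be^-1.
have be_neq0 : be != 0 by rewrite gt_eqF.
split; first by rewrite invr_gt0.
- by rewrite ea ev scalerA mulNr divfK // scaleNr addrK.
- by rewrite ev scalerA mulVf // scale1r.
Qed.

Lemma same_lineb_sym : symmetric same_lineb.
Proof. by move=> p q; apply/asboolP/asboolP; apply: same_line_sym. Qed.

Lemma same_lineb_trans : transitive same_lineb.
Proof.
move=> q p r /asboolP [al [be [be0 ea ev]]] /asboolP [al' [be' [be0' ea' ev']]].
apply/asboolP; exists (al + al' * be), (be' * be); split.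
- exact: mulr_gt0.
- by rewrite ea' ea ev scalerA scalerDl addrA.
- by rewrite ev' ev scalerA.
Qed.

Canonical same_line_equiv :=
  EquivRel same_lineb same_lineb_refl same_lineb_sym same_lineb_trans.

Definition oriented_line := {eq_quot same_line_equiv}.

(* Columns a, v_0, ..., v_(d-2). *)
Definition column_matrix (a : 'cV[R]_d) (v : 'I_d.-1 -> 'cV[R]_d) : 'M[R]_d :=
  \matrix_(r < d, c < d) (nth 0 (a :: codom v) c) r ord0.

Definition height_rep (p : 'I_d.-1 -> line_rep) (i : 'I_d.-1) : R :=
  \det (column_matrix (base_point (p i)) (fun j => direction (p j))).

(* Computed on canonical representatives; by [height_repE] below, another
   choice multiplies all heights of the tuple by a common positive factor. *)
Definition height (L : 'I_d.-1 -> oriented_line) : 'I_d.-1 -> R :=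
  height_rep (fun i => repr (L i)).

Definition general_position (L : 'I_d.-1 -> oriented_line) : Prop :=
  injective (height L).

Definition has_type (L : 'I_d.-1 -> oriented_line) (s : 'S_d.-1) : Prop :=
  forall i j : 'I_d.-1, (i < j)%N -> height L (s i) < height L (s j).

Definition homogeneous n (K : 'I_n -> oriented_line) (s : 'S_d.-1) : Prop :=
  forall f : 'I_d.-1 -> 'I_n, (forall i j : 'I_d.-1, (i < j)%N -> (f i < f j)%N) ->
    general_position (K \o f) /\ has_type (K \o f) s.

Definition universal_type (s : 'S_d.-1) : Prop :=
  forall n, (d.-1 <= n)%N ->
    exists K : 'I_n -> oriented_line, homogeneous K s.

End OrientedLines.

Lemma column_matrixE (R : realType) m (a : 'cV[R]_(1 + m)) v :
  column_matrix a v = row_mx a (\matrix_(r < 1 + m, c < m) v c r ord0).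
Proof.
apply/matrixP => r c; rewrite !mxE; case: splitP => j ->.
  by rewrite !ord1.
rewrite /= mxE (nth_map j); last by rewrite size_enum_ord; exact: ltn_ord.
by rewrite nth_ord_enum.
Qed.

Lemma det_column_matrix_change (R : realType) m (a : 'cV[R]_(1 + m))
    (v : 'I_m -> 'cV[R]_(1 + m)) (al : R) (be : 'I_m -> R) (i : 'I_m) :
  \det (column_matrix (a + al *: v i) (fun j => be j *: v j)) =
  (\prod_j be j) * \det (column_matrix a v).
Proof.
rewrite !column_matrixE.
set V := \matrix_(r, c) v c r ord0.
have -> : row_mx (a + al *: v i) (\matrix_(r, c) (be c *: v c) r ord0) =
    row_mx a V *m
    block_mx 1%:M 0 (al *: delta_mx i 0) (diag_mx (\row_j be j)).
  rewrite mul_row_block mulmx1 mulmx0 add0r; congr row_mx.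
    congr (_ + _); rewrite -scalemxAr -colE; congr (_ *: _).
    by apply/matrixP => r c; rewrite !mxE ord1.
  by apply/matrixP => r c; rewrite mul_mx_diag !mxE mulrC.
rewrite det_mulmx det_lblock det1 mul1r det_diag mulrC.
by congr (_ * _); apply: eq_bigr => j _; rewrite mxE.
Qed.

Lemma height_repE (R : realType) d (L : 'I_d.-1 -> oriented_line R d)
    (p : 'I_d.-1 -> line_rep R d) :
  (forall i, \pi_(oriented_line R d) (p i) = L i) ->
  exists2 c : R, 0 < c & forall i, height_rep p i = c * height L i.
Proof.
case: d L p => [|m] L p pL; first by exists 1 => // -[].
have /choice [al /choice [be E]] i : exists al be, [/\ 0 < be,
    base_point (p i) = base_point (repr (L i)) + al *: direction (repr (L i)) &
    direction (p i) = be *: direction (repr (L i))].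
  suff /asboolP : same_lineb (repr (L i)) (p i) by [].
  by apply/eqmodP; rewrite reprK pL.
exists (\prod_i be i) => [|i]; first by apply: prodr_gt0 => i _; case: (E i).
rewrite /height /height_rep -(det_column_matrix_change _ _ (al i) be i).
have [_ -> _] := E i; congr (\det (column_matrix _ _)).
by apply/funext => j; have [_ _ ->] := E j.
Qed.

Lemma general_position_rep (R : realType) d (L : 'I_d.-1 -> oriented_line R d)
    (p : 'I_d.-1 -> line_rep R d) :
  (forall i, \pi_(oriented_line R d) (p i) = L i) ->
  general_position L <-> injective (height_rep p).
Proof.
move=> /height_repE [c c0 E]; split=> inj i j.
  by rewrite !E => /(mulfI (lt0r_neq0 c0)) /inj.
by move=> eqh; apply: inj; rewrite !E eqh.
Qed.

Lemma has_type_rep (R : realType) d (L : 'I_d.-1 -> oriented_line R d)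
    (p : 'I_d.-1 -> line_rep R d) (s : 'S_d.-1) :
  (forall i, \pi_(oriented_line R d) (p i) = L i) ->
  has_type L s <->
  forall i j : 'I_d.-1, (i < j)%N -> height_rep p (s i) < height_rep p (s j).
Proof.
move=> /height_repE [c c0 E].
by split=> H i j /H; rewrite !E ltr_pM2l.
Qed.

(* Main.v *)
(** Take the directions [v_j] on the moment curve, at nodes [-t_j] with
[t_1 > ... > t_m > 0] and [m = d - 1].  Up to the positive Vandermonde factor,
the height of a base point [a] is then the pairing of [a] with the coefficients
of [Q = \prod_j (X + t_j)].  For the line of rank [i] choose
[a_k = lambda * c_k * x^k] with [c_k = 1] or [-1], where [x] lies just below
[t_i].  If the nodes are widely separated, one monomial of [Q(x)], whose degree
depends only on [i], dominates all the others, so the height has the sign of the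
corresponding [c_k]: any pattern of signs by rank can be prescribed.  With
[lambda] growing quickly along the sequence of lines, the absolute values of the
heights increase with the rank, and the types obtained are those in which each
new index is inserted above or below all the previous ones; there are
[2^(m-1)] of them.  With [lambda] decreasing quickly one gets the mirror image
family, and only the two monotone types are in both. *)

Require Import Defs.
From mathcomp Require Import all_boot all_order all_algebra all_fingroup.
From mathcomp Require Import boolp reals.
From mathcomp Require Import zify lra.

Set Implicit Arguments.
Unset Strict Implicit.
Unset Printing Implicit Defensive.

Import Order.TTheory GRing.Theory Num.Theory.
Local Open Scope ring_scope.

(** * Rankings of indices and end insertions *)

Lemma ranking_perm m (key : 'I_m -> int) : injective key ->
  exists r : 'S_m, forall i j, (r i < r j)%N = (key i < key j).
Proof.
move=> key_inj; pose below i := [set j | key j < key i].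
have rk_lt i : (#|below i| < m)%N.
  rewrite -[ltnRHS]card_ord -cardsT proper_card // properT.
  by apply/eqP => /setP /(_ i); rewrite !inE ltxx.
have rk_mono i j : key i < key j -> (#|below i| < #|below j|)%N.
  move=> ltij; apply: proper_card; apply/properP; split.
    by apply/subsetP => k; rewrite !inE => /lt_trans; apply.
  by exists i; rewrite !inE ?ltxx.
have rk_ltE i j : (#|below i| < #|below j|)%N = (key i < key j).
  have [/rk_mono //|/rk_mono lt|/key_inj ->] := ltgtP (key i) (key j).
    by rewrite ltnNge ltnW.
  by rewrite ltnn.
have rk_inj : injective (fun i => Ordinal (rk_lt i)).
  move=> i j [eq_rk]; apply: key_inj; apply/le_anti.
  by rewrite !leNgt -!rk_ltE eq_rk ltnn.
by exists (perm rk_inj) => i j; rewrite !permE rk_ltE.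
Qed.

Lemma perm_ltnN m (r : 'S_m) i j : i != j -> (r i < r j)%N = ~~ (r j < r i)%N.
Proof.
by move=> neij; rewrite -leqNgt ltn_neqAle val_eqE (inj_eq perm_inj) neij.
Qed.

Lemma perm_ltn_count m (r : 'S_m) i : \sum_(j | (r j < r i)%N) 1 = r i :> nat.
Proof.
rewrite -[RHS]card_ord -sum1_card big_mkcond /=.
rewrite -(big_ord_narrow (F := fun=> 1%N) (ltnW (ltn_ord (r i)))) /=.
by rewrite -big_mkcond [RHS](reindex_perm r).
Qed.

Lemma eq_perm_ltn m (r r' : 'S_m) :
  (forall i j, (r i < r j)%N = (r' i < r' j)%N) -> r = r'.
Proof.
move=> E; apply/permP => i; apply: val_inj => /=.
by rewrite -(perm_ltn_count r) -(perm_ltn_count r'); apply: eq_bigl => j.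
Qed.

(* Inserting the indices one by one in the order of increasing [w], each new
   index ranks above all the previous ones or below all of them. *)
Definition end_insertions m (w : 'I_m -> nat) : {set 'S_m} :=
  [set r : 'S_m | [forall i, forall j, forall k,
     (w i < w k)%N && (w j < w k)%N ==> ((r i < r k)%N == (r j < r k)%N)]].

Lemma end_insertionsP m (w : 'I_m -> nat) (r : 'S_m) :
  reflect (forall i j k, (w i < w k)%N -> (w j < w k)%N ->
             (r i < r k)%N = (r j < r k)%N)
          (r \in end_insertions w).
Proof.
rewrite inE; apply: (iffP 'forall_'forall_forallP) => H i j k.
  by move=> wi wj; have := H i j k; rewrite wi wj => /eqP.
by apply/implyP => /andP[wi wj]; rewrite (H i j).
Qed.

Lemma card_end_insertions m (w : 'I_m -> nat) i0 : injective w -> w i0 = 0%N ->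
  (2 ^ m.-1 <= #|end_insertions w|)%N.
Proof.
move=> w_inj w0.
(* [S] collects the indices inserted below. The absolute value of a key grows with [w], so each new
   key falls outside the range of the earlier ones. The first index [i0] has no choice to make,
   whence the subsets of [[set~ i0]]. *)
pose key (S : {set 'I_m}) i : int :=
  if i \in S then - (w i).+1%:Z else (w i).+1%:Z.
have key_inj S : injective (key S).
  by move=> i j; rewrite /key => E; apply: w_inj; move: E; do 2!case: ifP; lia.
have [r rE] : exists r : {set 'I_m} -> 'S_m, forall S i j,
    (r S i < r S j)%N = (key S i < key S j).
  have ex S := ranking_perm (@key_inj S).
  by have [r rP] := choice ex; exists r.
have -> : (2 ^ m.-1)%N = #|powerset [set~ i0]|.
  by rewrite card_powerset cardsC1 card_ord.
have r_inj : {in powerset [set~ i0] &, injective r}.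
  have i0N (S : {set 'I_m}) : S \in powerset [set~ i0] -> i0 \notin S.
    by rewrite inE => /subsetP/(_ i0); rewrite !inE eqxx => /contraFN; apply.
  have memE (S : {set 'I_m}) i : i0 \notin S -> (i \in S) = (r S i < r S i0)%N.
    by rewrite rE /key => /negPf ->; rewrite w0; case: ifP; lia.
  move=> S S' /i0N S0 /i0N S0' eqr.
  by apply/setP => i; rewrite (memE S) // (memE S') // eqr.
rewrite -(card_in_imset r_inj) subset_leq_card //.
apply/subsetP => _ /imsetP[S _ ->]; apply/end_insertionsP => i j k.
by rewrite !rE /key; do 3!case: ifP; lia.
Qed.

(* A ranking that is end-inserted from both sides is monotone, and the
   comparison of the two extreme indices tells which way. *)
Lemma card_end_insertionsI m :
  (#|end_insertions (fun i : 'I_m.+1 => i : nat) :&: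
     end_insertions (fun i : 'I_m.+1 => m - i)%N| <= 2)%N.
Proof.
rewrite -card_bool.
apply: (@leq_card_in _ _ (fun r : 'S_m.+1 => r ord0 < r ord_max)%N) => //.
have mono (r : 'S_m.+1) (i j : 'I_m.+1) :
    r \in end_insertions (fun i : 'I_m.+1 => i : nat) :&:
          end_insertions (fun i : 'I_m.+1 => m - i)%N ->
    (i < j)%N -> (r i < r j)%N = (r ord0 < r ord_max)%N.
  case/setIP => /end_insertionsP up /end_insertionsP down ltij.
  have lt0j : (0 < j)%N by apply: leq_ltn_trans ltij.
  (* [up] replaces [i] by [ord0]; then, with both comparisons reversed, [down] replaces [j] by
     [ord_max]. *)
  rewrite (up i ord0) //.
  have lejm : (j <= m)%N by rewrite -ltnS.
  have lt0m : (0 < m)%N by apply: leq_trans lejm.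
  have flip (k : 'I_m.+1) : (0 < k)%N -> (r ord0 < r k)%N = ~~ (r k < r ord0)%N.
    by move=> k0; rewrite perm_ltnN // -val_eqE ltn_eqF.
  by rewrite !flip // (down j ord_max ord0) //=; lia.
move=> r r' rI r'I eqb; apply: eq_perm_ltn => i j.
case: (ltngtP i j) => [lt|gt|/val_inj ->]; last by rewrite !ltnn.
  by rewrite (mono r) // (mono r') //.
have neij : i != j by rewrite -val_eqE gtn_eqF.
by rewrite !(perm_ltnN _ neij) (mono r) // (mono r') //; congr (~~ _).
Qed.

(** * Determinants on the moment curve *)

Section MomentCurve.
Variables (R : realType) (m : nat).

(** The top power comes first so that splitting off the first row leaves a Vandermonde matrix. *)
Definition moment (x : R) : 'cV[R]_(1 + m) :=
  col_mx (x ^+ m)%:M (\col_(k < m) x ^+ k).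

Lemma moment_neq0 (x : R) : (0 < m)%N -> moment x != 0.
Proof.
move=> m_gt0; apply/eqP => /matrixP/(_ (rshift 1 (Ordinal m_gt0)) 0).
by rewrite col_mxEd !mxE expr0 => /eqP; rewrite oner_eq0.
Qed.

(* Row operations replace the top row of the matrix by its product with the
   coefficients of the polynomial vanishing at all the nodes. *)
Lemma det_moment (c : nat -> R) (t : 'I_m -> R) :
  \det (@column_matrix R m.+1 (col_mx (0 : 'cV_1) (\col_(k < m) c k))
          (fun j : 'I_m => moment (t j))) =
  (\prod_(i < m) \prod_(j < m | (i < j)%N) (t j - t i)) *
  \sum_(k < m) c k * (\prod_j ('X - (t j)%:P))`_k.
Proof.
set P := \prod_j _.
have szP : size P = m.+1.
  by rewrite size_prod_XsubC /index_enum -enumT size_enum_ord.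
have Pm : P`_m = 1.
  have /monicP := monic_prod_XsubC (index_enum 'I_m) predT t.
  by rewrite lead_coefE szP.
pose q : 'rV[R]_m := \row_k P`_k.
pose V := Vandermonde m (\row_j t j).
rewrite column_matrixE.
have -> : \matrix_(r < 1 + m, c0 < m) moment (t c0) r ord0 =
    col_mx (\row_j t j ^+ m) V.
  apply/matrixP => r j; rewrite !mxE; case: splitP => k _; rewrite !mxE //.
  by rewrite !ord1 eqxx.
have detU : \det (block_mx 1%:M q 0 1%:M : 'M_(1 + m)) = 1.
  by rewrite det_ublock !det1 mulr1.
rewrite -[LHS]mul1r -[X in X * _ = _]detU -det_mulmx.
have -> : row_mx (col_mx 0 (\col_(k < m) c k)) (col_mx (\row_j t j ^+ m) V) =
   block_mx 0 (\row_j t j ^+ m) (\col_(k < m) c k) V.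
  by rewrite block_mxEh.
rewrite mulmx_block !mul1mx !mul0mx !add0r.
have -> : \row_j t j ^+ m + q *m V = 0.
  apply/matrixP => i j; rewrite !mxE.
  have : P.[t j] = 0.
    by rewrite horner_prod (bigD1 j) //= hornerXsubC subrr mul0r.
  rewrite (horner_coef_wide _ (_ : size P <= m.+1)%N) ?szP // big_ord_recr /=.
  rewrite Pm mul1r => PE; rewrite -[RHS]PE addrC; congr (_ + _).
  by apply: eq_bigr => k _; rewrite !mxE.
rewrite det_lblock det_Vandermonde mulrC; congr (_ * _).
  by apply: eq_bigr => i _; apply: eq_bigr => j _; rewrite !mxE.
rewrite det_mx11 !mxE; apply: eq_bigr => k _; rewrite !mxE; exact: mulrC.
Qed.

End MomentCurve.

(** * Domination by one monomial, and lines with prescribed height signs *)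

Lemma coef_le_prod (R : numDomainType) (I : Type) (s : seq I) (p q : I -> {poly R}) :
  (forall i k, 0 <= (p i)`_k <= (q i)`_k) ->
  forall k, 0 <= (\prod_(i <- s) p i)`_k <= (\prod_(i <- s) q i)`_k.
Proof.
move=> pq; pose K (p q : {poly R}) := forall k, 0 <= p`_k <= q`_k.
apply: (big_ind2 K) => [k|p1 q1 p2 q2 H1 H2 k|i _ //].
  by rewrite coef1 lexx ler0n.
rewrite !coefM sumr_ge0 /= => [|i _]; last first.
  by apply: mulr_ge0; [case/andP: (H1 i)|case/andP: (H2 (k - i)%N)].
apply: ler_sum => i _.
by apply: ler_pM; [case/andP: (H1 i)|case/andP: (H2 (k - i)%N)
                  |case/andP: (H1 i)|case/andP: (H2 (k - i)%N)].
Qed.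

(** Convexity: the right side is the chord of the left side over [[0, 1]]. *)
Lemma expr1D_le (R : realDomainType) (x : R) m : 0 <= x <= 1 ->
  (1 + x) ^+ m <= 1 + (2 ^+ m - 1) * x.
Proof.
move=> /andP[x0 x1]; elim: m => [|m IH]; first by rewrite !expr0 subrr mul0r addr0.
have A1 : 1 <= 2 ^+ m :> R by apply: exprn_ege1; lra.
rewrite !exprSr; move: IH A1; set y := _ ^+ m; set A := 2 ^+ m => IH A1.
apply: (le_trans (ler_wpM2r (_ : 0 <= 1 + x) IH)); first lra.
have : 0 <= (A - 1) * (x * (1 - x)) by rewrite !mulr_ge0 // subr_ge0.
lra.
Qed.

(* If every node is much larger or much smaller than [x], then one term of the
   expansion of [\prod_j (x + t j)] dominates the sum of all the others. *)
Lemma dominant_coef (R : realFieldType) m (t : 'I_m -> R) (x T M : R)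
    (J : pred 'I_m) (c : nat -> R) :
  2 ^+ m.+1 <= T -> 0 < x -> (forall j, 0 < t j) ->
  (forall j, if J j then T * x <= t j else T * t j <= x) ->
  (forall k, `|c k| <= 1) -> (#|predC J| < m)%N ->
  M = \prod_j (if J j then t j else x) ->
  `|\sum_(k < m) c k * x ^+ k * (\prod_j ('X + (t j)%:P))`_k
     - c #|predC J| * M| <= M / 2.
Proof.
move=> hT x0 t0 tJ c1 gm defM.
set Q := \prod_j _; set g := #|_|.
have T0 : 0 < T by apply: lt_le_trans hT; apply: exprn_gt0; lra.
have T1 : 1 <= T by apply: le_trans hT; apply: exprn_ege1; lra.
(* The term of the expansion that takes the larger summand in each factor; its value at [x] is
   [M]. *)
pose p : {poly R} := \prod_j (if J j then (t j)%:P else 'X).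
have pQ k : 0 <= p`_k <= Q`_k.
  apply: coef_le_prod => j {}k; rewrite coefD coefX coefC.
  have tj := ltW (t0 j).
  by case: (J j); rewrite ?coefC ?coefX; do 2!case: eqP => //= _; lra.
pose M0 := \prod_(j | J j) t j.
have pE : p = M0 *: 'X^g.
  rewrite /p (bigID J) /= -mul_polyC rmorph_prod /=; congr (_ * _).
    by apply: eq_bigr => j ->.
  rewrite (eq_bigr (fun=> 'X)) => [|j /negPf -> //].
  by rewrite prodr_const.
have ME : M = M0 * x ^+ g.
  rewrite defM (bigID J) /=; congr (_ * _); first by apply: eq_bigr => j ->.
  rewrite (eq_bigr (fun=> x)) => [|j /negPf -> //].
  by rewrite prodr_const.
have M_gt0 : 0 < M by rewrite defM; apply: prodr_gt0 => j _; case: ifP.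
have szQ : (size Q <= m.+1)%N.
  rewrite /Q (eq_bigr (fun j => 'X - (- t j)%:P)); last first.
    by move=> j _; rewrite polyCN opprK.
  by rewrite size_prod_XsubC /index_enum -enumT size_enum_ord.
have szp : (size p <= m.+1)%N.
  by rewrite pE (leq_trans (size_scale_leq _ _)) // size_polyXn ltnW.
have cM : c g * M = \sum_(k < m) c k * x ^+ k * p`_k.
  rewrite (bigD1 (Ordinal gm)) //= big1 ?addr0 => [|k kg].
    by rewrite pE coefZ coefXn eqxx ME mulr1 -mulrA [M0 * _]mulrC.
  have /negPf kg' : (k : nat) != g by apply: contraNneq kg => kg; apply/eqP/val_inj.
  by rewrite pE coefZ coefXn kg' !mulr0.
rewrite cM -sumrB.
have Qx : Q.[x] <= M * (1 + T^-1) ^+ m.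
  have -> : M * (1 + T^-1) ^+ m = \prod_j ((if J j then t j else x) * (1 + T^-1)).
    by rewrite defM big_split /= prodr_const card_ord.
  rewrite horner_prod; apply: ler_prod => j _; rewrite hornerD hornerX hornerC.
  rewrite (addr_ge0 (ltW x0) (ltW (t0 j))) /= mulrDr mulr1.
  have := tJ j; case: (J j) => tj.
    by rewrite addrC lerD2l ler_pdivlMr // mulrC.
  by rewrite lerD2l ler_pdivlMr // mulrC.
have bern : (1 + T^-1) ^+ m <= 3 / 2.
  have Ti : 0 <= T^-1 <= 1 by rewrite invr_ge0 ltW //= invf_le1.
  apply: (le_trans (expr1D_le m Ti)).
  suff : (2 ^+ m - 1) * T^-1 <= 1 / 2 by lra.
  by rewrite ler_pdivrMr //; move: hT; rewrite exprSr; lra.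
have px : p.[x] = M by rewrite pE hornerZ hornerXn ME.
(* As [Q - p] has nonnegative coefficients and [c] is bounded by 1, the error is at most [Q.[x] -
   M], hence at most [M / 2] by [Qx] and [bern]. *)
suff : `|\sum_(k < m) (c k * x ^+ k * Q`_k - c k * x ^+ k * p`_k)| <= Q.[x] - p.[x].
  move/le_trans; apply; rewrite px.
  have : M * (1 + T^-1) ^+ m <= M * (3 / 2) by rewrite ler_pM2l.
  by lra.
apply: le_trans (ler_norm_sum _ _ _) _.
rewrite (horner_coef_wide _ szQ) (horner_coef_wide _ szp) -sumrB big_ord_recr /=.
rewrite -[leLHS]addr0; apply: lerD; last first.
  by rewrite -mulrBl mulr_ge0 ?exprn_ge0 ?(ltW x0) // subr_ge0; case/andP: (pQ m).
apply: ler_sum => k _; rewrite -mulrBr -mulrBl !normrM normrX (gtr0_norm x0).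
have d0 : 0 <= Q`_k - p`_k by rewrite subr_ge0; case/andP: (pQ k).
rewrite (ger0_norm d0) mulrC ler_wpM2l // -[leRHS]mul1r.
by rewrite ler_wpM2r // exprn_ge0 // ltW.
Qed.

(* On lines placed along the moment curve at rapidly separated nodes, the sign
   of a height depends only on the rank of the line in the tuple, and scaling
   the base points makes the absolute values of the heights follow [W]. *)
Lemma lines_with_height_signs (R : realType) m n (e : 'I_m.+1 -> bool)
    (W : 'I_n -> nat) :
  exists p : 'I_n -> line_rep R m.+2,
  forall f : 'I_m.+1 -> 'I_n, (forall i j : 'I_m.+1, (i < j)%N -> (f i < f j)%N) ->
  forall i k : 'I_m.+1, (W (f i) < W (f k))%N ->
    `|@height_rep R m.+2 (p \o f) i| <
      (-1) ^+ e k * @height_rep R m.+2 (p \o f) k.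
Proof.
pose T : R := 2 ^+ m.+2.
have T1 : 1 < T by apply: exprn_egt1 => //; lra.
have T0 : 0 < T by lra.
(* Nodes have even exponents and [x l] the odd exponent just below that of [t l], a factor [T] away
   from both neighbouring nodes. Since [l < n], the predecessor never truncates. *)
pose t (l : 'I_n) : R := T ^+ (n - l).*2.
pose x (l : 'I_n) : R := T ^+ (n - l).*2.-1.
pose B : R := T ^+ (n.*2 * m.+1).
have B1 : 1 <= B by apply: exprn_ege1; lra.
(* Up to the common factor [D], absolute heights lie between [lam l / 2] and [2 * B * lam l]; the
   ratio [4 * B] keeps these ranges apart. *)
pose lam (l : 'I_n) : R := (4 * B) ^+ W l.
have lam0 l : 0 < lam l by apply: exprn_gt0; lra.
(* The monomial dominating at rank [i] has degree [m - i]. *)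
pose c (k : nat) : R := (-1) ^+ e (inord (m - k)).
have c1 k : `|c k| <= 1 by rewrite normrX normrN1 expr1n.
have t0 l : 0 < t l by apply: exprn_gt0.
have x0 l : 0 < x l by apply: exprn_gt0.
pose a l : 'cV[R]_(1 + m.+1) :=
  col_mx (0 : 'cV_1) (\col_(k < m.+1) (lam l * (c k * x l ^+ k))).
pose p l : line_rep R m.+2 :=
  exist (fun p : 'cV[R]_m.+2 * 'cV[R]_m.+2 => p.2 != 0) (a l, moment m.+1 (- t l))
    (moment_neq0 (- t l) (ltn0Sn m)).
exists p => f f_incr.
pose D := \prod_(i < m.+1) \prod_(j < m.+1 | (i < j)%N) (- t (f j) - - t (f i)).
have D0 : 0 < D.
  apply: prodr_gt0 => i _; apply: prodr_gt0 => j ltij.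
  rewrite opprK addrC subr_gt0 ltr_eXn2l //.
  by have := f_incr _ _ ltij; have := ltn_ord (f j); lia.
pose S i := \sum_(k < m.+1) c k * x (f i) ^+ k *
              (\prod_j ('X + (t (f j))%:P))`_k.
have hE i : @height_rep R m.+2 (p \o f) i = D * (lam (f i) * S i).
  rewrite /height_rep /base_point /direction /=.
  rewrite (det_moment (fun k => lam (f i) * (c k * x (f i) ^+ k))).
  congr (_ * _); rewrite mulr_sumr; apply: eq_bigr => k _.
  rewrite -[LHS]mulrA; congr (_ * (_ * nth 0 (polyseq _) k)).
  by apply: eq_bigr => j _; rewrite polyCN opprK.
have SP i : `|S i| < 2 * B /\ 1 / 2 <= (-1) ^+ e i * S i.
  pose J : pred 'I_m.+1 := fun j => (j <= i)%N.
  have cardJ : #|predC J| = (m - i)%N.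
    have : (#|J| + #|predC J|)%N = m.+1 by rewrite cardC card_ord.
    have -> : #|J| = i.+1.
      rewrite -[RHS]card_ord -sum1_card -[RHS]sum1_card.
      by rewrite -(big_ord_narrow (F := fun=> 1%N) (ltn_ord i)).
    by lia.
  pose M := \prod_j (if J j then t (f j) else x (f i)).
  have ce : c #|predC J| = (-1) ^+ e i.
    rewrite /c cardJ; congr ((-1) ^+ nat_of_bool (e _)); apply: val_inj.
    by rewrite /= inordK; have := ltn_ord i; lia.
  have tJ j : if J j then T * x (f i) <= t (f j) else T * t (f j) <= x (f i).
    have := ltn_ord (f i); have := ltn_ord (f j).
    rewrite /J; case: (ltngtP j i) => [/f_incr|/f_incr|/val_inj ->];
      by rewrite -exprS ler_eXn2l //; lia.
  have M1 : 1 <= M.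
    apply: (big_ind (fun y => 1 <= y)) => // [y z|j _]; first exact: mulr_ege1.
    by case: ifP => _; apply: exprn_ege1; lra.
  have MB : M <= B.
    have -> : B = \prod_(j < m.+1) T ^+ n.*2 by rewrite prodr_const card_ord -exprM.
    apply: ler_prod => j _.
    by case: ifP => _; rewrite exprn_ge0 ?(ltW T0) //= ler_eXn2l //; lia.
  have := @dominant_coef R m.+1 (t \o f) (x (f i)) T M J c (lexx _) (x0 _)
            (fun j => t0 (f j)) tJ c1 _ erefl.
  rewrite ce cardJ => /(_ (leq_subr _ _)); rewrite -/(S i) ler_norml.
  case: (e i); rewrite ?expr1 ?expr0 => /andP[lo hi]; split; rewrite ?ltr_norml; lra.
move=> i k ltW; rewrite !hE !normrM (gtr0_norm D0) (gtr0_norm (lam0 _)).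
rewrite [ltRHS]mulrCA ltr_pM2l // [ltRHS]mulrCA.
have [Si _] := SP i; have [_ Sk] := SP k.
have lamS : lam (f i) * (4 * B) <= lam (f k).
  by rewrite -exprSr ler_eXn2l //; lra.
apply: (@lt_le_trans _ _ (lam (f i) * (2 * B))); first by rewrite ltr_pM2l.
apply: (@le_trans _ _ (lam (f k) * (1 / 2))); first lra.
by rewrite ler_pM2l.
Qed.

(** * Universality of the end insertions, and their count *)

Lemma end_insertions_universal (R : realType) m (w : 'I_m.+1 -> nat)
    (s : 'S_m.+1) :
  injective w ->
  (forall n, exists W : 'I_n -> nat, forall f : 'I_m.+1 -> 'I_n,
     (forall i j : 'I_m.+1, (i < j)%N -> (f i < f j)%N) ->
     forall i k, (w i < w k)%N -> (W (f i) < W (f k))%N) ->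
  (s^-1)%g \in end_insertions w -> @universal_type R m.+2 s.
Proof.
move=> w_inj hW /end_insertionsP ins n _; have [W WP] := hW n.
(* A type lists the indices by increasing height; its inverse gives the rank of each index. *)
set r := (s^-1)%g in ins.
(* [e k] holds when [k] goes below the earlier indices; by [ins], any single earlier index decides
   this. *)
pose e k := [exists i, (w i < w k)%N && (r k < r i)%N].
have eE i k : (w i < w k)%N -> e k = (r k < r i)%N.
  move=> ltik; apply/existsP/idP => [[j /andP[ltjk rkj]]|rki]; last first.
    by exists i; rewrite ltik.
  have neq (l : 'I_m.+1) : (w l < w k)%N -> k != l.
    by apply: contraTneq => <-; rewrite ltnn.
  by rewrite perm_ltnN ?neq // (ins i j) // -perm_ltnN ?neq.
have [p pP] := @lines_with_height_signs R m n e W.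
exists (fun l => \pi_(oriented_line R m.+2) (p l))%qT => f f_incr.
set h := @height_rep R m.+2 (p \o f).
have h_lt (i k : 'I_m.+1) : (w i < w k)%N ->
    if (r k < r i)%N then h k < h i else h i < h k.
  move=> ltik; have := pP f f_incr i k (WP f f_incr i k ltik).
  rewrite (eE i) // -/h; case: ifP => _; rewrite ?expr1 ?expr0 ltr_norml; lra.
have hs (i j : 'I_m.+1) : (i < j)%N -> h (s i) < h (s j).
  move=> ltij; have rs l : r (s l) = l by rewrite /r permK.
  have := h_lt (s i) (s j); have := h_lt (s j) (s i); rewrite !rs ltij.
  rewrite [(j < i)%N]ltnNge (ltnW ltij) /=.
  case: (ltngtP (w (s i)) (w (s j))) => [_ _ ->|_ -> //|/w_inj/perm_inj eqij] //.
  by rewrite eqij ltnn in ltij.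
have piE i : (\pi_(oriented_line R m.+2) ((p \o f) i))%qT =
    ((fun l => \pi_(oriented_line R m.+2) (p l))%qT \o f) i by [].
split; last exact/(has_type_rep _ piE).
apply/(general_position_rep piE) => i j hij; apply: w_inj.
by case: (ltngtP (w i) (w j)) => // /h_lt; rewrite /h hij ltxx; case: ifP.
Qed.

Theorem theorem3p3 (R : realType) (d : nat) (hd : (3 <= d)%N) :
  exists A : {set 'S_d.-1},
    (2 ^ d.-1 - 2 <= #|A|)%N /\
    (forall s : 'S_d.-1, s \in A -> universal_type R s).
Proof.
case: d hd => [|[|m]] // _.
pose up := fun i : 'I_m.+1 => i : nat.
pose down := fun i : 'I_m.+1 => (m - i)%N.
have down_inj : injective down.
  by move=> i j; rewrite /down => E; apply: val_inj => /=; have := ltn_ord i;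
    have := ltn_ord j; lia.
exists (invg @: (end_insertions up :|: end_insertions down)).
split.
  rewrite (card_imset _ (@invg_inj _)).
  have := cardsUI (end_insertions up) (end_insertions down).
  have := @card_end_insertions _ up ord0 val_inj erefl.
  have := @card_end_insertions _ down ord_max down_inj (subnn m).
  have := card_end_insertionsI m; rewrite -/up -/down /= => cI cdown cup cUI.
  rewrite expnS mul2n -addnn leq_subLR.
  by apply: leq_trans (leq_add cup cdown) _; rewrite -cUI addnC leq_add2r.
move=> s /imsetP[r /setUP[] ins def_s]; rewrite -[r]invgK -def_s in ins.
  apply: end_insertions_universal ins => [|n]; first exact: val_inj.
  exists val => f f_incr i k; exact: f_incr.
apply: end_insertions_universal ins => // n.
(* Scales decrease along the sequence, so that absolute heights follow [down]. *)
exists (fun l => n - l)%N => f f_incr i k; rewrite /down => ltik.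
have ltki : (k < i)%N by lia.
by have := f_incr _ _ ltki; have := ltn_ord (f i); lia.
Qed.
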